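(* Let $a\in(0,1)$ and $b\ge 1-a$ be real numbers, and put $$\alpha=a(b+1),\quad \beta=b(1-a),\quad p=\alpha+\beta=a+b,\quad h=\alpha\beta(p+\beta),\quad k=\beta(p+1)+p.$$ Assume that either $\alpha\ge\sqrt3\,\beta$, or both $\alpha<\sqrt3\,\beta$ and $4h(\beta+p)\ge p^4$. If $c,d\in(0,\infty)$ satisfy $0<c/d\le(\beta+p)/k$, then $$\sup\{\delta\in(a-1,0)\mid F(a-1,b;a+b;1-x^c)<F(a-1-\delta,b+\delta;a+b;1-x^d)\ \text{for all } x\in(0,1)\}=\frac{a-b-1+\sqrt{(p-1)^2+4\beta c/d}}{2}.$$
   Context: $F(a,b;c;x)={}_2F_1(a,b;c;x)=\sum_{n=0}^\infty\frac{(a,n)(b,n)}{(c,n)}\frac{x^n}{n!}$ for $x\in(-1,1)$ is the Gaussian hypergeometric function, where $(a,n)=a(a+1)\cdots(a+n-1)$ for $n\ge1$ and $(a,0)=1$. *)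

(* Defs.v *)
From Stdlib Require Import Reals Factorial.
From Coquelicot Require Import Coquelicot.
Open Scope R_scope.

Fixpoint rising (a : R) (n : nat) : R :=
  match n with
  | O => 1
  | S m => rising a m * (a + INR m)
  end.

(* [PSeries] is total: the value is the intended one when c is not a
   nonpositive integer and |x| < 1. *)
Definition hyp2F1 (a b c x : R) : R :=
  PSeries (fun n => rising a n * rising b n / rising c n / INR (fact n)) x.

(* Main.v *)
Require Import Defs.
From Stdlib Require Import Reals Factorial Lra.
From Coquelicot Require Import Coquelicot.
Open Scope R_scope.

(** Write [C = A + B + 1] with [-1 < A < 0 < B] and [G y = F(A, B; C; y)].  For
    the parameters of the statement the sum [A + B] is the same on both sides;
    only the product [A * B] changes with [delta].

    Upper bound.  Both sides equal 1 at [x = 1], where their derivatives are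
    [- A B c / C] and [- A' B' d / C].  An inequality on [(0, 1)] therefore
    forces [c A B <= d A' B'] ([hyp_power_compare_necessary]).  The number
    [delta0] in the statement is the root of
    [(a-1-delta) (b+delta) = (c/d) (a-1) b] in [(a-1, 0)], and the left side
    decreases in [delta] there, so [delta <= delta0].

    The bound is attained: the inequality holds for [delta0] itself
    ([hyp_power_compare]).  Because [C = A + B + 1], the hypergeometric equation
    has a factor [1 - y] in front of its whole derivative part:
    [(1-y) (y G'' + C G') = A B G] ([hyp_ode]).  All Taylor coefficients of
    [G] but the first are negative, so [G'] and [G''] are negative on [[0, 1)],
    and then the equation gives [G > 0].
    With [x^d = exp (-s)] and [lam = c/d < 1] the claim is [v < w] for [s > 0],
    where [v s = G1 (1 - exp (- lam s))] and [w s = G2 (1 - exp (-s))].  Let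
    [W = v' w - v w'] be their Wronskian.  The two differential equations
    give, with [z = exp (-s)] and [Z = exp (- lam s)],
    [(1-z) W' = - (1 - z + C z) W + w lam Z X], where
    [X = (1-lam) (1-z) G1' + (lam Z (1-z) - z (1-Z)) G1''] with [G1'] and
    [G1''] taken at [1 - Z].
    The last bracket is nonnegative by convexity of the exponential
    ([exp_convex_bound]), so [X < 0].  Hence [W' < 0] wherever [W >= 0], and
    as [W 0 = 0] this makes [W] negative for [s > 0]
    ([neg_of_deriv_neg_when_nonneg]).  So [v / w] decreases strictly from its
    value 1 at [s = 0].

    The condition on [c/d] enters through [c < d], which gives [lam < 1]. *)

(** * Taylor coefficients *)

Definition hyp_coef (A B C : R) (n : nat) : R :=
  rising A n * rising B n / rising C n / INR (fact n).

(** Parameters with [A + B + 1 = C], the case where the hypergeometric equation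
    degenerates to [hyp_ode], in the range where [A * B] is negative and
    [A + 1] positive. *)
Definition admissible (A B C : R) : Prop :=
  -1 < A < 0 /\ 0 < B /\ C = A + B + 1.

Definition dhyp (A B C : R) : R -> R := PSeries (PS_derive (hyp_coef A B C)).
Definition d2hyp (A B C : R) : R -> R :=
  PSeries (PS_derive (PS_derive (hyp_coef A B C))).

Lemma rising_pos (C : R) (n : nat) : 0 < C -> 0 < rising C n.
Proof.
  intros HC; induction n as [|n IH]; simpl; [lra|].
  apply Rmult_lt_0_compat; [exact IH|]. pose proof (pos_INR n); lra.
Qed.

Lemma hyp_coef_S (A B C : R) (n : nat) : 0 < C ->
  hyp_coef A B C (S n)
  = hyp_coef A B C n * ((A + INR n) * (B + INR n) / ((C + INR n) * (INR n + 1))).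
Proof.
  intros HC; unfold hyp_coef.
  pose proof (rising_pos C n HC). pose proof (pos_INR n).
  pose proof (INR_fact_lt_0 n).
  rewrite fact_simpl, mult_INR, S_INR; simpl rising.
  field; repeat split; lra.
Qed.

Lemma hyp_coef_1 (A B C : R) : 0 < C -> hyp_coef A B C 1 = A * B / C.
Proof. intros HC; unfold hyp_coef; simpl; field; lra. Qed.

Lemma hyp_coef_neg (A B C : R) (n : nat) :
  admissible A B C -> hyp_coef A B C (S n) < 0.
Proof.
  intros (HA & HB & HC). induction n as [|n IH].
  - rewrite hyp_coef_1 by lra.
    apply Ropp_lt_cancel; rewrite Ropp_0.
    replace (- (A * B / C)) with ((- A) * B / C) by (field; lra).
    apply Rdiv_lt_0_compat; nra.
  - rewrite hyp_coef_S by lra. pose proof (pos_INR n).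
    rewrite S_INR.
    assert (0 < (A + (INR n + 1)) * (B + (INR n + 1))
                / ((C + (INR n + 1)) * (INR n + 1 + 1))).
    { apply Rdiv_lt_0_compat; apply Rmult_lt_0_compat; lra. }
    nra.
Qed.

(** The consecutive ratio is [(n+A) (n+B) / ((n+C) (n+1))], of modulus at most 1:
    for [n = 0] this is [(A+1) (B+1) >= 0].  It bounds the radius of convergence
    below by 1 without any limit computation. *)
Lemma hyp_coef_bound (A B C : R) (n : nat) :
  admissible A B C -> Rabs (hyp_coef A B C n) <= 1.
Proof.
  intros (HA & HB & HC). induction n as [|n IH].
  - unfold hyp_coef; simpl.
    replace (1 * 1 / 1 / 1) with 1 by field. rewrite Rabs_R1; lra.
  - rewrite hyp_coef_S, Rabs_mult by lra. pose proof (pos_INR n) as Hn.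
    set (r := (A + INR n) * (B + INR n) / ((C + INR n) * (INR n + 1))).
    assert (Hd : 0 < (C + INR n) * (INR n + 1)) by (apply Rmult_lt_0_compat; lra).
    assert (Hr : Rabs r <= 1).
    { apply Rabs_le; unfold r; split.
      - apply Rle_div_r; [exact Hd|]. nra.
      - apply Rle_div_l; [exact Hd|]. nra. }
    pose proof (Rabs_pos r); pose proof (Rabs_pos (hyp_coef A B C n)). nra.
Qed.

Lemma hyp_radius (A B C y : R) :
  admissible A B C -> Rabs y < 1 -> Rbar_lt (Rabs y) (CV_radius (hyp_coef A B C)).
Proof.
  intros Had Hy. apply Rbar_lt_le_trans with (Finite 1); [exact Hy|].
  destruct (CV_radius_bounded (hyp_coef A B C)) as [Hub _].
  apply Hub. exists 1; intros n. rewrite pow1, Rmult_1_r.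
  now apply hyp_coef_bound.
Qed.

Lemma PSeries_neg (u : nat -> R) (y : R) :
  0 <= y -> Rbar_lt (Rabs y) (CV_radius u) -> (forall n, u n < 0) ->
  PSeries u y < 0.
Proof.
  intros Hy Hr Hu. pose proof (CV_radius_inside _ _ Hr) as Hex.
  rewrite PSeries_decr_1 by exact Hex.
  assert (Hle : 0 <= PSeries (PS_opp (PS_decr_1 u)) y).
  { unfold PSeries.
    replace 0 with (Series (fun _ : nat => 0 * 0)).
    2: { rewrite Series_scal_l; ring. }
    apply Series_le.
    - intros n. unfold PS_opp, PS_decr_1. split; [lra|].
      rewrite Rmult_0_l. specialize (Hu (S n)).
      pose proof (pow_le y n Hy).
      apply Rmult_le_pos; [change (0 <= - u (S n)); lra|assumption].
    - assert (Hr' : Rbar_lt (Rabs y) (CV_radius (PS_opp (PS_decr_1 u)))).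
      { rewrite CV_radius_opp, CV_radius_decr_1; exact Hr. }
      apply CV_radius_inside in Hr'. apply ex_pseries_R in Hr'. exact Hr'. }
  rewrite PSeries_opp in Hle. specialize (Hu O). nra.
Qed.

(** * The hypergeometric differential equation *)

Lemma hyp2F1_derive (A B C y : R) :
  admissible A B C -> Rabs y < 1 ->
  is_derive (hyp2F1 A B C) y (dhyp A B C y).
Proof.
  intros Had Hy. apply (is_derive_PSeries (hyp_coef A B C)).
  now apply hyp_radius.
Qed.

Lemma dhyp_derive (A B C y : R) :
  admissible A B C -> Rabs y < 1 ->
  is_derive (dhyp A B C) y (d2hyp A B C y).
Proof.
  intros Had Hy. apply is_derive_PSeries. rewrite CV_radius_derive.
  now apply hyp_radius.
Qed.

Lemma dhyp_neg (A B C y : R) :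
  admissible A B C -> 0 <= y < 1 -> dhyp A B C y < 0.
Proof.
  intros Had Hy. apply PSeries_neg; [lra| |].
  - rewrite CV_radius_derive. apply hyp_radius; [exact Had|].
    rewrite Rabs_pos_eq; lra.
  - intros n. unfold PS_derive. pose proof (hyp_coef_neg A B C n Had).
    pose proof (pos_INR n). rewrite S_INR. nra.
Qed.

Lemma d2hyp_neg (A B C y : R) :
  admissible A B C -> 0 <= y < 1 -> d2hyp A B C y < 0.
Proof.
  intros Had Hy. apply PSeries_neg; [lra| |].
  - rewrite !CV_radius_derive. apply hyp_radius; [exact Had|].
    rewrite Rabs_pos_eq; lra.
  - intros n. unfold PS_derive. pose proof (hyp_coef_neg A B C (S n) Had).
    pose proof (pos_INR n). rewrite !S_INR.
    assert (0 < (INR n + 1) * (INR n + 1 + 1)) by nra. nra.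
Qed.

Lemma hyp2F1_0 (A B C : R) : hyp2F1 A B C 0 = 1.
Proof. unfold hyp2F1. rewrite PSeries_0; simpl; field. Qed.

Lemma dhyp_0 (A B C : R) : 0 < C -> dhyp A B C 0 = A * B / C.
Proof.
  intros HC; unfold dhyp; rewrite PSeries_0; unfold PS_derive.
  rewrite hyp_coef_1 by exact HC. simpl; ring.
Qed.

(** The series [e] of [y G'' + C G'] has coefficients
    [e n = (n+A) (n+B) h n], where [h n] are those of [G].  Since [C = A + B + 1]
    one has [(n+1) (n+A+B+1) h (n+1) = e n], whence [e n - e (n-1) = A B h n],
    which is the claim. *)
Lemma hyp_ode (A B C y : R) :
  admissible A B C -> Rabs y < 1 ->
  (1 - y) * (y * d2hyp A B C y + C * dhyp A B C y) = A * B * hyp2F1 A B C y.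
Proof.
  intros Had Hy. pose proof (hyp_radius A B C y Had Hy) as Hr.
  set (h := hyp_coef A B C) in *.
  assert (H0 : ex_pseries h y) by now apply CV_radius_inside.
  assert (H1 : ex_pseries (PS_derive h) y)
    by (apply CV_radius_inside; rewrite CV_radius_derive; exact Hr).
  assert (H2 : ex_pseries (PS_derive (PS_derive h)) y)
    by (apply CV_radius_inside; rewrite !CV_radius_derive; exact Hr).
  set (e := (PS_plus (PS_incr_1 (PS_derive (PS_derive h)))
                     (PS_scal C (PS_derive h)) : nat -> R)).
  assert (He1 : ex_pseries (PS_incr_1 (PS_derive (PS_derive h))) y)
    by (apply ex_pseries_incr_1; exact H2).
  assert (He2 : ex_pseries (PS_scal C (PS_derive h)) y)
    by (apply ex_pseries_scal; [apply Rmult_comm|exact H1]).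
  assert (He : ex_pseries e y) by (apply ex_pseries_plus; assumption).
  assert (HE : y * d2hyp A B C y + C * dhyp A B C y = PSeries e y).
  { unfold e. rewrite PSeries_plus by assumption.
    rewrite PSeries_incr_1, PSeries_scal. reflexivity. }
  rewrite HE.
  destruct Had as (HA & HB & HC).
  assert (Hen : forall n, e n = (A + INR n) * (B + INR n) * h n).
  { intros n. transitivity ((INR n + 1) * (C + INR n) * h (S n)).
    - unfold e, PS_plus, PS_scal, PS_incr_1, PS_derive.
      destruct n as [|n]; [simpl; unfold plus, scal, zero; simpl; unfold mult; simpl; ring|].
      rewrite !S_INR. unfold plus, scal; simpl; unfold mult; simpl. ring.
    - unfold h. rewrite hyp_coef_S by lra. pose proof (pos_INR n).
      field. lra. }
  assert (Hrec : PSeries e y = y * PSeries e y + A * B * PSeries h y).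
  { rewrite <- PSeries_incr_1, <- PSeries_scal, <- PSeries_plus.
    - apply PSeries_ext. intros n.
      unfold PS_plus, PS_scal, PS_incr_1; rewrite Hen.
      unfold plus, scal; simpl; unfold mult; simpl.
      destruct n as [|n]; [simpl; unfold zero; simpl; ring|].
      rewrite Hen. unfold h. rewrite hyp_coef_S by lra.
      pose proof (pos_INR n). rewrite S_INR. rewrite HC. field. lra.
    - apply ex_pseries_incr_1; exact He.
    - apply ex_pseries_scal; [apply Rmult_comm|exact H0]. }
  change (hyp2F1 A B C y) with (PSeries h y). lra.
Qed.

(** By [hyp_ode], [A B G] is [1 - y] times a negative quantity, and
    [A B < 0]. *)
Lemma hyp2F1_pos (A B C y : R) :
  admissible A B C -> 0 <= y < 1 -> 0 < hyp2F1 A B C y.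
Proof.
  intros Had Hy.
  pose proof (hyp_ode A B C y Had ltac:(rewrite Rabs_pos_eq; lra)) as Hode.
  pose proof (dhyp_neg A B C y Had Hy). pose proof (d2hyp_neg A B C y Had Hy).
  destruct Had as (HA & HB & HC).
  assert (HE : y * d2hyp A B C y + C * dhyp A B C y < 0) by nra.
  assert (A * B * hyp2F1 A B C y < 0) by nra.
  assert (A * B < 0) by nra. nra.
Qed.

(** * Sign of a derivative and convexity of the exponential *)

Lemma derive_nonneg_of_left_max (f : R -> R) (l r m : R) :
  r < m -> is_derive f m l -> (forall t, r < t < m -> f t <= f m) -> 0 <= l.
Proof.
  intros Hrm Hder Hmax. apply Rnot_lt_le; intros Hl.
  apply is_derive_Reals in Hder.
  destruct (Hder (- l) ltac:(lra)) as [eps Heps].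
  pose proof (cond_pos eps) as He.
  set (t := Rmin (eps / 2) ((m - r) / 2)).
  pose proof (Rmin_l (eps / 2) ((m - r) / 2)) as Ht1.
  pose proof (Rmin_r (eps / 2) ((m - r) / 2)) as Ht2.
  assert (Ht : 0 < t) by (apply Rmin_glb_lt; lra).
  fold t in Ht1, Ht2.
  specialize (Heps (- t) ltac:(lra) ltac:(rewrite Rabs_Ropp, Rabs_pos_eq; lra)).
  apply Rabs_def2 in Heps. destruct Heps as [Hup _].
  specialize (Hmax (m + - t) ltac:(lra)).
  assert (Hq : 0 <= (f m - f (m + - t)) / t) by (apply Rdiv_le_0_compat; lra).
  replace ((f (m + - t) - f m) / - t) with ((f m - f (m + - t)) / t) in Hup
    by (field; lra).
  lra.
Qed.

(** Otherwise the maximum of [W] over some [[0, s0]] would be nonnegative and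
    attained at a positive point, where [W] cannot have a negative derivative.
    This form of the sign argument tolerates a differential inequality for [W]
    whose coefficients blow up at 0. *)
Lemma neg_of_deriv_neg_when_nonneg (W W' : R -> R) :
  (forall s, 0 <= s -> is_derive W s (W' s)) -> W 0 = 0 ->
  (forall s, 0 < s -> 0 <= W s -> W' s < 0) ->
  forall s, 0 < s -> W s < 0.
Proof.
  intros Hd H0 Hneg s0 Hs0. apply Rnot_le_lt; intros Hge.
  assert (Hno : forall m, 0 < m -> 0 <= W m ->
            (forall t, 0 <= t <= m -> W t <= W m) -> False).
  { intros m Hm Hpos Hmax.
    apply (Rlt_not_le _ _ (Hneg m Hm Hpos)).
    apply (derive_nonneg_of_left_max W (W' m) 0 m Hm); [apply Hd; lra|].
    intros t Ht; apply Hmax; lra. }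
  destruct (continuity_ab_maj W 0 s0) as [m [Hmax Hm]]; [lra| |].
  { intros t Ht. apply continuity_pt_filterlim.
    apply (ex_derive_continuous W). exists (W' t). apply Hd; lra. }
  destruct (Rle_lt_or_eq_dec 0 m (proj1 Hm)) as [Hm0|Hm0].
  - apply (Hno m Hm0).
    + apply Rle_trans with (W s0); [exact Hge|apply Hmax; lra].
    + intros t Ht; apply Hmax; lra.
  - (* The maximum is then [W 0 = 0 <= W s0], so [s0] is a maximum as well. *)
    subst m. apply (Hno s0 Hs0 Hge).
    intros t Ht. apply Rle_trans with (W 0); [apply Hmax; lra|lra].
Qed.

(** Divided by [exp (- s) * exp (- (lam * s))], this is
    [exp (lam s) <= lam exp s + (1 - lam) exp 0]. *)
Lemma exp_convex_bound (lam s : R) : 0 < lam < 1 -> 0 < s ->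
  exp (- s) * (1 - exp (- (lam * s)))
  <= lam * exp (- (lam * s)) * (1 - exp (- s)).
Proof.
  intros Hl Hs.
  pose proof (exp_ineq1_le ((1 - lam) * s)) as HP.
  pose proof (exp_ineq1_le (- (lam * s))) as HQ.
  pose proof (exp_pos (- s)) as Hz.
  assert (HZ : exp (- (lam * s)) = exp (- s) * exp ((1 - lam) * s))
    by (rewrite <- exp_plus; f_equal; ring).
  set (P := exp ((1 - lam) * s)) in *. set (Z := exp (- (lam * s))) in *.
  set (z := exp (- s)) in *.
  assert (0 <= z * (lam * P - 1 + (1 - lam) * Z)) by (apply Rmult_le_pos; nra).
  replace (lam * Z * (1 - z)) with (z * (lam * P) * (1 - z)) by (rewrite HZ; ring).
  assert (z * (1 - lam * P - (1 - lam) * Z) <= 0) by lra.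
  assert (z * (lam * P) * z = lam * z * Z) by (rewrite HZ; ring). lra.
Qed.

Lemma exp_opp_bounds (s : R) : 0 <= s -> 0 <= 1 - exp (- s) < 1.
Proof.
  intros Hs. pose proof (exp_pos (- s)).
  assert (exp (- s) <= 1).
  { destruct Hs as [Hs| <-].
    - rewrite <- exp_0; left; apply exp_increasing; lra.
    - rewrite Ropp_0, exp_0; lra. }
  lra.
Qed.

(** * Comparison in the logarithmic variable *)

Definition hyp_exp (A B C mu s : R) : R := hyp2F1 A B C (1 - exp (- (mu * s))).

Definition dhyp_exp (A B C mu s : R) : R :=
  mu * exp (- (mu * s)) * dhyp A B C (1 - exp (- (mu * s))).

Lemma hyp_exp_derive (A B C mu s : R) :
  admissible A B C -> 0 < mu -> 0 <= s ->
  is_derive (hyp_exp A B C mu) s (dhyp_exp A B C mu s).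
Proof.
  intros Had Hmu Hs. unfold hyp_exp, dhyp_exp.
  pose proof (exp_opp_bounds (mu * s) ltac:(nra)).
  apply (is_derive_comp (hyp2F1 A B C) (fun s => 1 - exp (- (mu * s)))).
  - apply hyp2F1_derive; [exact Had|rewrite Rabs_pos_eq; lra].
  - auto_derive; [trivial|ring].
Qed.

Lemma dhyp_exp_derive (A B C mu s : R) :
  admissible A B C -> 0 < mu -> 0 <= s ->
  let Z := exp (- (mu * s)) in
  is_derive (dhyp_exp A B C mu) s
    (mu ^ 2 * Z ^ 2 * d2hyp A B C (1 - Z) - mu ^ 2 * Z * dhyp A B C (1 - Z)).
Proof.
  intros Had Hmu Hs Z. unfold dhyp_exp.
  pose proof (exp_opp_bounds (mu * s) ltac:(nra)).
  assert (H1 : is_derive (fun s => dhyp A B C (1 - exp (- (mu * s)))) s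
                 (mu * Z * d2hyp A B C (1 - Z))).
  { apply (is_derive_comp (dhyp A B C) (fun s => 1 - exp (- (mu * s)))).
    - apply dhyp_derive; [exact Had|]. unfold Z in *. rewrite Rabs_pos_eq; lra.
    - auto_derive; [trivial|unfold Z; ring]. }
  assert (H2 : is_derive (fun s => mu * exp (- (mu * s))) s (- mu ^ 2 * Z))
    by (auto_derive; [trivial|unfold Z; ring]).
  evar_last; [apply (is_derive_mult _ _ _ _ _ H2 H1); intros; apply Rmult_comm|].
  unfold plus, mult; simpl; unfold mult; simpl. fold Z. ring.
Qed.

(** Strict decrease of the quotient of the two sides, from the sign of their
    Wronskian. *)
Lemma hyp_exp_compare (A1 B1 A2 B2 C lam : R) :
  admissible A1 B1 C -> admissible A2 B2 C -> 0 < lam < 1 ->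
  A2 * B2 = lam * (A1 * B1) ->
  forall s, 0 < s -> hyp_exp A1 B1 C lam s < hyp_exp A2 B2 C 1 s.
Proof.
  intros H1 H2 Hlam HAB.
  set (v := hyp_exp A1 B1 C lam). set (w := hyp_exp A2 B2 C 1).
  set (v' := dhyp_exp A1 B1 C lam). set (w' := dhyp_exp A2 B2 C 1).
  assert (Dv : forall s, 0 <= s -> is_derive v s (v' s))
    by (intros; apply hyp_exp_derive; [exact H1|lra|assumption]).
  assert (Dw : forall s, 0 <= s -> is_derive w s (w' s))
    by (intros; apply hyp_exp_derive; [exact H2|lra|assumption]).
  assert (v0 : v 0 = 1).
  { unfold v, hyp_exp. rewrite Rmult_0_r, Ropp_0, exp_0, Rminus_diag.
    apply hyp2F1_0. }
  assert (w0 : w 0 = 1).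
  { unfold w, hyp_exp. rewrite Rmult_0_r, Ropp_0, exp_0, Rminus_diag.
    apply hyp2F1_0. }
  assert (wpos : forall s, 0 <= s -> 0 < w s).
  { intros s Hs. apply hyp2F1_pos; [exact H2|].
    apply exp_opp_bounds; lra. }
  assert (HW : forall s, 0 < s -> v' s * w s - v s * w' s < 0).
  { set (v'' := fun s => let Z := exp (- (lam * s)) in
      lam ^ 2 * Z ^ 2 * d2hyp A1 B1 C (1 - Z) - lam ^ 2 * Z * dhyp A1 B1 C (1 - Z)).
    set (w'' := fun s => let Z := exp (- (1 * s)) in
      1 ^ 2 * Z ^ 2 * d2hyp A2 B2 C (1 - Z) - 1 ^ 2 * Z * dhyp A2 B2 C (1 - Z)).
    apply (neg_of_deriv_neg_when_nonneg (fun s => v' s * w s - v s * w' s)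
             (fun s => v'' s * w s - v s * w'' s)).
    - intros s Hs.
      assert (Dv2 : is_derive v' s (v'' s))
        by (apply dhyp_exp_derive; [exact H1|lra|assumption]).
      assert (Dw2 : is_derive w' s (w'' s))
        by (apply dhyp_exp_derive; [exact H2|lra|assumption]).
      evar_last.
      + apply @is_derive_minus.
        * apply (is_derive_mult _ _ _ _ _ Dv2 (Dw s Hs)); intros; apply Rmult_comm.
        * apply (is_derive_mult _ _ _ _ _ (Dv s Hs) Dw2); intros; apply Rmult_comm.
      + unfold minus, plus, opp, mult; simpl; unfold mult; simpl. ring.
    - rewrite v0, w0. unfold v', w', dhyp_exp.
      rewrite !Rmult_0_r, Ropp_0, exp_0, Rminus_diag.
      destruct H1 as (HA1 & HB1 & HC1).
      rewrite !dhyp_0 by lra. rewrite HAB. field. lra.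
    - intros s Hs HWs.
      pose proof (wpos s ltac:(lra)) as Hw.
      pose proof (exp_convex_bound lam s Hlam Hs) as Hconv.
      pose proof (exp_opp_bounds (lam * s) ltac:(nra)) as HYb.
      pose proof (exp_opp_bounds s ltac:(lra)) as Hyb.
      assert (Hy0 : 0 < 1 - exp (- s)).
      { rewrite <- exp_0 at 1. pose proof (exp_increasing (- s) 0 ltac:(lra)). lra. }
      unfold v'', w'', v', w', dhyp_exp in *. cbv zeta.
      unfold v, w, hyp_exp in *.
      rewrite !Rmult_1_l in *.
      set (Z := exp (- (lam * s))) in *. set (z := exp (- s)) in *.
      pose proof (hyp_ode A1 B1 C (1 - Z) H1 ltac:(rewrite Rabs_pos_eq; lra)) as O1.
      pose proof (hyp_ode A2 B2 C (1 - z) H2 ltac:(rewrite Rabs_pos_eq; lra)) as O2.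
      pose proof (dhyp_neg A1 B1 C (1 - Z) H1 HYb) as N1.
      pose proof (d2hyp_neg A1 B1 C (1 - Z) H1 HYb) as N2.
      set (g := hyp2F1 A1 B1 C (1 - Z)) in *. set (g1 := dhyp A1 B1 C (1 - Z)) in *.
      set (g2 := d2hyp A1 B1 C (1 - Z)) in *.
      set (f := hyp2F1 A2 B2 C (1 - z)) in *. set (f1 := dhyp A2 B2 C (1 - z)) in *.
      set (f2 := d2hyp A2 B2 C (1 - z)) in *.
      assert (HZ : 0 < Z) by apply exp_pos. assert (Hz : 0 < z) by apply exp_pos.
      assert (HC : 0 < C) by (destruct H1 as (?&?&?); lra).
      (* [X] and the identity [HD] come from eliminating the second derivative of
         the right-hand function and then [A1 * B1 * g] by the two equations. *)
      set (X := (1 - lam) * (1 - z) * g1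
                + (lam * Z * (1 - z) - z * (1 - Z)) * g2).
      assert (HX : X < 0).
      { unfold X.
        assert (0 < (1 - lam) * (1 - z)) by (apply Rmult_lt_0_compat; lra).
        nra. }
      assert (HD : (1 - z) * ((lam ^ 2 * Z ^ 2 * g2 - lam ^ 2 * Z * g1) * f
                     - g * (1 ^ 2 * z ^ 2 * f2 - 1 ^ 2 * z * f1))
                   = f * lam * Z * X
                     - (1 - z + C * z) * (lam * Z * g1 * f - g * (z * f1))).
      { replace (1 - (1 - Z)) with Z in O1 by ring.
        replace (1 - (1 - z)) with z in O2 by ring.
        assert (E2 : z * ((1 - z) * f2) = lam * (A1 * B1) * f - z * C * f1) by nra.
        assert (E1 : A1 * B1 * g = Z * (1 - Z) * g2 + Z * C * g1) by nra.
        transitivity ((1 - z) * (lam ^ 2 * Z ^ 2 * g2 - lam ^ 2 * Z * g1) * f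
           - g * z * (z * ((1 - z) * f2)) + g * (1 - z) * z * f1); [ring|].
        rewrite E2.
        transitivity ((1 - z) * (lam ^ 2 * Z ^ 2 * g2 - lam ^ 2 * Z * g1) * f
           - z * lam * f * (A1 * B1 * g) + g * z * z * C * f1
           + g * (1 - z) * z * f1); [ring|].
        rewrite E1. unfold X. ring. }
      assert (f * lam * Z * X < 0).
      { assert (0 < f * lam * Z) by (repeat apply Rmult_lt_0_compat; lra). nra. }
      assert (0 <= (1 - z + C * z) * (lam * Z * g1 * f - g * (z * f1))).
      { apply Rmult_le_pos; [nra|lra]. }
      nra. }
  intros s Hs.
  set (q := fun t => v t / w t).
  assert (Dq : forall t, 0 <= t ->
            is_derive q t ((v' t * w t - v t * w' t) / w t ^ 2)).
  { intros t Ht. unfold q.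
    pose proof (wpos t Ht) as Hw.
    evar_last.
    - apply is_derive_div; [apply (Dv t Ht)|apply (Dw t Ht)|lra].
    - unfold minus, plus, opp, mult, scal; simpl; reflexivity. }
  assert (Hq : q s < 1).
  { assert (q0 : q 0 = 1) by (unfold q; rewrite v0, w0; field).
    destruct (MVT_cor2 q (fun t => (v' t * w t - v t * w' t) / w t ^ 2) 0 s Hs)
      as [t [Heq Ht]].
    { intros t Ht; apply is_derive_Reals, Dq; lra. }
    assert (0 < (- (v' t * w t - v t * w' t)) / w t ^ 2).
    { apply Rdiv_lt_0_compat; [pose proof (HW t ltac:(lra)); lra|].
      apply pow_lt, wpos; lra. }
    rewrite Rdiv_opp_l in H. nra. }
  unfold q in Hq. pose proof (wpos s ltac:(lra)) as Hw.
  apply Rlt_div_l in Hq; lra.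
Qed.

(** * Powers of the variable *)

(** Sufficiency, in the borderline case where both sides have the same slope at
    [x = 1]; the substitution is [s = - d ln x]. *)
Lemma hyp_power_compare (A1 B1 A2 B2 C c d x : R) :
  admissible A1 B1 C -> admissible A2 B2 C -> 0 < c < d ->
  d * (A2 * B2) = c * (A1 * B1) -> 0 < x < 1 ->
  hyp2F1 A1 B1 C (1 - Rpower x c) < hyp2F1 A2 B2 C (1 - Rpower x d).
Proof.
  intros H1 H2 Hcd HAB Hx.
  assert (Hln : ln x < 0) by (rewrite <- ln_1; apply ln_increasing; lra).
  pose proof (hyp_exp_compare A1 B1 A2 B2 C (c / d) H1 H2) as Hcmp.
  specialize (Hcmp ltac:(split;
    [apply Rdiv_lt_0_compat; lra|apply Rlt_div_l; lra])).
  specialize (Hcmp ltac:(apply Rmult_eq_reg_l with d; [|lra]; rewrite HAB; field; lra)).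
  specialize (Hcmp (- (d * ln x)) ltac:(nra)).
  unfold hyp_exp in Hcmp. unfold Rpower.
  replace (c * ln x) with (- (c / d * - (d * ln x))) by (field; lra).
  replace (d * ln x) with (- (1 * - (d * ln x))) at 2 by ring.
  exact Hcmp.
Qed.

Lemma hyp_power_derive_1 (A B C c : R) :
  admissible A B C ->
  is_derive (fun x => hyp2F1 A B C (1 - Rpower x c)) 1 (- (A * B / C * c)).
Proof.
  intros Had. assert (HC : 0 < C) by (destruct Had as (?&?&?); lra).
  evar_last.
  - apply (is_derive_comp (hyp2F1 A B C) (fun x => 1 - Rpower x c)).
    + apply hyp2F1_derive; [exact Had|].
      unfold Rpower; rewrite ln_1, Rmult_0_r, exp_0, Rminus_diag, Rabs_R0; lra.
    + unfold Rpower. auto_derive; [lra|reflexivity].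
  - unfold Rpower; rewrite ln_1, Rmult_0_r, exp_0, Rminus_diag, dhyp_0 by exact HC.
    unfold scal; simpl; unfold mult; simpl. field. lra.
Qed.

(** Both sides equal 1 at [x = 1], so the inequality to the left of 1 orders the
    derivatives of [hyp_power_derive_1] there. *)
Lemma hyp_power_compare_necessary (A1 B1 A2 B2 C c d : R) :
  admissible A1 B1 C -> admissible A2 B2 C ->
  (forall x, 0 < x < 1 ->
     hyp2F1 A1 B1 C (1 - Rpower x c) <= hyp2F1 A2 B2 C (1 - Rpower x d)) ->
  c * (A1 * B1) <= d * (A2 * B2).
Proof.
  intros H1 H2 Hle. assert (HC : 0 < C) by (destruct H1 as (?&?&?); lra).
  pose proof (is_derive_minus _ _ _ _ _
    (hyp_power_derive_1 A1 B1 C c H1) (hyp_power_derive_1 A2 B2 C d H2)) as Hd.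
  apply (derive_nonneg_of_left_max _ _ 0 1 Rlt_0_1) in Hd.
  - unfold minus, plus, opp in Hd; simpl in Hd.
    apply Rmult_le_reg_l with (/ C); [apply Rinv_0_lt_compat; exact HC|].
    unfold Rdiv in Hd. lra.
  - intros x Hx. specialize (Hle x Hx).
    unfold minus, plus, opp; simpl.
    replace (Rpower 1 c) with 1
      by (unfold Rpower; rewrite ln_1, Rmult_0_r, exp_0; reflexivity).
    replace (Rpower 1 d) with 1
      by (unfold Rpower; rewrite ln_1, Rmult_0_r, exp_0; reflexivity).
    rewrite Rminus_diag, !hyp2F1_0. lra.
Qed.

Theorem theorem1p2 (a b c d : R) :
  let alpha := a * (b + 1) in
  let beta := b * (1 - a) in
  let p := a + b in
  let h := alpha * beta * (p + beta) in
  let k := beta * (p + 1) + p in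
  0 < a < 1 ->
  1 - a <= b ->
  (sqrt 3 * beta <= alpha
   \/ (alpha < sqrt 3 * beta /\ p ^ 4 <= 4 * h * (beta + p))) ->
  0 < c ->
  0 < d ->
  0 < c / d <= (beta + p) / k ->
  is_lub
    (fun delta : R =>
       a - 1 < delta < 0 /\
       forall x : R, 0 < x < 1 ->
         hyp2F1 (a - 1) b (a + b) (1 - Rpower x c)
         < hyp2F1 (a - 1 - delta) (b + delta) (a + b) (1 - Rpower x d))
    ((a - b - 1 + sqrt ((p - 1) ^ 2 + 4 * beta * (c / d))) / 2).
Proof.
  intros alpha beta p h k Ha Hb _ Hc Hd [Hlam0 Hlam].
  assert (Hbeta : 0 < beta) by (unfold beta; nra).
  assert (Hp : 1 <= p) by (unfold p; lra).
  assert (Hlam1 : c / d < 1).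
  { apply Rle_lt_trans with (1 := Hlam). unfold k.
    apply Rlt_div_l; nra. }
  assert (Hcd : c < d) by (apply Rlt_div_l in Hlam1; lra).
  set (lam := c / d) in *.
  assert (Hc_lam : c = lam * d) by (unfold lam; field; lra).
  set (r := sqrt ((p - 1) ^ 2 + 4 * beta * lam)).
  assert (Hrad : 0 < 4 * beta * lam)
    by (apply Rmult_lt_0_compat; [apply Rmult_lt_0_compat; [lra|assumption]|assumption]).
  assert (Hr2 : r * r = (p - 1) ^ 2 + 4 * beta * lam)
    by (apply sqrt_sqrt; pose proof (pow2_ge_0 (p - 1)); lra).
  assert (Hr0 : 0 <= r) by apply sqrt_pos.
  set (delta0 := (a - b - 1 + r) / 2).
  (* The product is [((p-1)^2 - r^2) / 4], as the two factors are
     [(p-1-r)/2] and [(p-1+r)/2]. *)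
  assert (Hroot : (a - 1 - delta0) * (b + delta0) = lam * ((a - 1) * b)).
  { transitivity (((p - 1) ^ 2 - r * r) / 4).
    - unfold delta0, p; field.
    - rewrite Hr2; unfold beta; field. }
  assert (Hlow : a - 1 < delta0).
  { unfold delta0. assert (p - 1 < r) by nra. unfold p in *; lra. }
  assert (Hhigh : delta0 < 0).
  { unfold delta0. assert (r < b + 1 - a); [|lra].
    assert ((b + 1 - a) ^ 2 = (p - 1) ^ 2 + 4 * beta) by (unfold p, beta; ring).
    nra. }
  assert (Hadm : forall delta, a - 1 < delta <= 0 ->
            admissible (a - 1 - delta) (b + delta) (a + b))
    by (intros delta Hdelta; repeat split; lra).
  assert (Hadm0 : admissible (a - 1) b (a + b)) by (repeat split; lra).
  split.
  - intros delta [Hdelta Hlt].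
    apply Rnot_lt_le; intros Hgt.
    assert (Hnec := hyp_power_compare_necessary _ _ _ _ _ c d Hadm0
      (Hadm delta ltac:(lra)) (fun x Hx => Rlt_le _ _ (Hlt x Hx))).
    rewrite Hc_lam in Hnec.
    assert (Hnec' : lam * ((a - 1) * b) <= (a - 1 - delta) * (b + delta)) by nra.
    rewrite <- Hroot in Hnec'. fold delta0 in Hgt. nra.
  - intros m Hm. apply Hm. split; [fold delta0; lra|].
    intros x Hx. fold delta0.
    apply hyp_power_compare;
      [exact Hadm0|apply Hadm; lra|lra|rewrite Hroot, Hc_lam; ring|exact Hx].
Qed.
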